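(* Let $P$ be a family of quasi-pseudometrics on a set $X$ generating a quasi-uniformity $\mathcal U=\mathcal U_P$ such that $(X,\mathcal U)$ is sequentially right $K$-complete. Let $\eta:\mathbb R_+\to\mathbb R_+$ be an upper semicontinuous function such that $\eta(t)<t$ for all $t>0$. Suppose that $f:X\to[0,\infty]$ satisfies: (a) for every sequence $(x_n)$ in $X$ and every $x\in X$, if $(x_n)$ is $\tau(\mathcal U)$-convergent to $x$ and $f(x_n)\to 0$, then $f(x)=0$; (b) there exists $\gamma>0$ such that for every $x\in X$ with $f(x)>0$ there exists $x'\in X$ such that (i) $f(x')+\gamma d(x',x)\le f(x)$ for all $d\in P$, and (ii) $f(x')\le\eta(f(x))$. Then for every $x_0\in\operatorname{dom} f$ there exists $\bar x\in X$ such that (i) $f(\bar x)=0=\inf f(X)$; and (ii) $d(\bar x,x_0)\le \dfrac{f(x_0)}{\gamma}$ for all $d\in P$.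
   Context: A quasi-pseudometric on $X$ is a function $d:X\times X\to\mathbb R_+=[0,\infty)$ with $d(x,x)=0$ and $d(x,z)\le d(x,y)+d(y,z)$ for all $x,y,z\in X$. A family $P$ of quasi-pseudometrics generates the quasi-uniformity $\mathcal U_P$ on $X$ having as subbasis the sets $V_{d,\varepsilon}=\{(x,y)\in X\times X:d(x,y)<\varepsilon\}$, $d\in P$, $\varepsilon>0$ (i.e. $\mathcal U_P$ consists of all supersets of finite intersections of such sets). The topology $\tau(\mathcal U)$ has $\{U(x):U\in\mathcal U\}$, $U(x)=\{y\in X:(x,y)\in U\}$, as neighborhood basis at $x$. A sequence $(x_n)$ is right $K$-Cauchy if for every $U\in\mathcal U$ there is $n_U\in\mathbb N$ such that $(x_{n+k},x_n)\in U$ for all $n\ge n_U$ and all $k\in\mathbb N$. $(X,\mathcal U)$ is sequentially right $K$-complete if every right $K$-Cauchy sequence is $\tau(\mathcal U)$-convergent to some point of $X$. $\operatorname{dom} f=\{x\in X:f(x)<\infty\}$. Convention: $\eta(\infty)=\infty$, so that the inequality $f(x')\le\eta(f(x))$ imposes nothing when $f(x)=\infty$. *)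

(* Defs.v *)
From HB Require Import structures.
From mathcomp Require Import all_boot all_order all_algebra.
From mathcomp Require Import all_classical all_reals all_analysis.

Set Implicit Arguments.
Unset Strict Implicit.
Unset Printing Implicit Defensive.
Import Order.TTheory GRing.Theory Num.Theory.
Import numFieldNormedType.Exports.
Local Open Scope classical_set_scope.
Local Open Scope ring_scope.

Definition quasi_pseudometric (R : realType) (X : Type) (d : X -> X -> R) :=
  [/\ forall x y, 0 <= d x y,
      forall x, d x x = 0 &
      forall x y z, d x z <= d x y + d y z].

Definition quasi_ent (R : realType) (X : Type) (d : X -> X -> R) (e : R) :
    set (X * X) :=
  [set p | d p.1 p.2 < e].

(* [finI_from] includes the empty intersection, so an empty family [P]
   generates the quasi-uniformity whose only member is [setT]. *)
Definition quasi_uniformity (R : realType) (X : Type)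
    (P : set (X -> X -> R)) : set_system (X * X) :=
  filter_from
    (finI_from [set quasi_ent d e | d in P & e in [set e : R | 0 < e]] id) id.

(* The neighborhood filter of [x] in the topology of [U]; a sequence [u]
   converges to [x] in that topology when [u @ \oo `=>` qnbhs U x]. *)
Definition qnbhs (X : Type) (U : set_system (X * X)) (x : X) : set_system X :=
  filter_from U (fun E => xsection E x).

Definition right_K_cauchy (X : Type) (U : set_system (X * X)) (u : nat -> X) :=
  forall E, U E ->
    exists nE : nat, forall n k : nat, (nE <= n)%N -> E (u (n + k)%N, u n).

Definition seq_right_K_complete (X : Type) (U : set_system (X * X)) :=
  forall u : nat -> X, right_K_cauchy U u -> exists x, u @ \oo `=>` qnbhs U x.

(* Upper semicontinuity of the restriction of [h] to the subspace [A]. *)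
Definition upper_semicontinuous_on (R : realType) (T : topologicalType)
    (A : set T) (h : T -> R) :=
  forall t a, A t -> h t < a -> \forall s \near within A (nbhs t), h s < a.

(* Main.v *)
Require Import Defs.
From HB Require Import structures.
From mathcomp Require Import all_boot all_order all_algebra.
From mathcomp Require Import all_classical all_reals all_analysis.
From mathcomp Require Import lra.

Set Implicit Arguments.
Unset Strict Implicit.
Unset Printing Implicit Defensive.
Import Order.TTheory GRing.Theory Num.Theory.
Import numFieldNormedType.Exports.
Local Open Scope classical_set_scope.
Local Open Scope ring_scope.

(** The point [xbar] is the limit of a descent sequence.  Starting from [x0],
    the hypothesis [hb] yields [u 0 = x0, u 1, u 2, ...] with
    [f (u n.+1) <= eta (f (u n))] and
    [gamma * d (u n.+1) (u n) <= f (u n) - f (u n.+1)] for every [d] in [P];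
    at a zero of [f] the sequence stays put.

    Two facts make it work.  Since [eta t < t], the values [f (u n)] decrease to
    some [t >= 0], and upper semicontinuity at [t] forces [t = 0]
    ([cvg0_of_usc_contraction]).  Since the decrements of [f] dominate the
    steps, the distances telescope:
    [gamma * d (u (n + k)) (u n) <= f (u n) - f (u (n + k)) <= f (u n)]
    ([telescope_dist]).  The distances are measured from later points to
    earlier ones, which is the order in right K-Cauchy sequences, and the bound
    does not depend on [d]; so [u] is right K-Cauchy, and completeness gives a
    limit, where [f] vanishes by [ha].  Taking [n = 0] in the telescoped bound
    and letting [k] tend to infinity gives [gamma * d xbar x0 <= f x0],
    because convergence in the topology of the quasi-uniformity says that
    [d xbar (u k)] tends to 0. *)

(** The limit [t] of the nonincreasing sequence [h] satisfies [t <= h n] for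
    all [n]; were it positive, [eta < t] would hold near [t] because
    [eta t < t], and then [h n.+1 <= eta (h n) < t] for large [n]. *)
Lemma cvg0_of_usc_contraction (R : realType) (eta : R -> R) (h : nat -> R) :
  upper_semicontinuous_on [set t : R | 0 <= t] eta ->
  (forall t, 0 < t -> eta t < t) ->
  (forall n, 0 <= h n) ->
  (forall n, h n.+1 <= h n) ->
  (forall n, 0 < h n -> h n.+1 <= eta (h n)) ->
  h n @[n --> \oo] --> (0 : R).
Proof.
move=> eta_usc eta_lt h_ge0 h_decr h_eta.
have h_homo : {homo h : n m / (n <= m)%N >-> m <= n} by apply/nonincreasing_seqP.
have h_cvg : cvgn h.
  by apply: nonincreasing_is_cvgn => //; exists 0 => _ [n _ <-].
have lim_le n : limn h <= h n by exact: nonincreasing_cvgn_ge.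
have lim_ge0 : 0 <= limn h by apply: limr_ge => //; exact: nearW.
have [lim_gt0|lim_le0] := ltP 0 (limn h); last first.
  suff <- : limn h = 0 by [].
  by apply/eqP; rewrite eq_le lim_le0.
have near_lim := eta_usc _ _ lim_ge0 (eta_lt _ lim_gt0).
have [N _ /(_ N (leqnn N)) /(_ (h_ge0 N)) eta_hN] := h_cvg _ near_lim.
have hN_gt0 : 0 < h N by exact: lt_le_trans lim_gt0 (lim_le N).
have := le_lt_trans (le_trans (lim_le N.+1) (h_eta N hN_gt0)) eta_hN.
by rewrite ltxx.
Qed.

Lemma telescope_dist (R : realType) (X : Type) (d : X -> X -> R) (gamma : R)
    (u : nat -> X) (h : nat -> R) :
  quasi_pseudometric d -> 0 < gamma ->
  (forall n, gamma * d (u n.+1) (u n) <= h n - h n.+1) ->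
  forall n k, gamma * d (u (n + k)%N) (u n) <= h n - h (n + k)%N.
Proof.
move=> [_ d_refl d_triangle] gamma_gt0 step n; elim=> [|k IHk].
  by rewrite addn0 d_refl mulr0 subrr.
rewrite addnS.
apply: le_trans (_ : gamma * (d (u (n + k).+1) (u (n + k)%N)
                              + d (u (n + k)%N) (u n)) <= _).
  by rewrite ler_pM2l.
by have := step (n + k)%N; rewrite mulrDr; lra.
Qed.

(** Finite intersections and supersets stay in a filter, so membership of a
    whole quasi-uniformity can be tested on the subbasic entourages. *)
Lemma quasi_uniformity_sub_filter (R : realType) (X : Type)
    (P : set (X -> X -> R)) (F : set_system (X * X)) :
  Filter F ->
  (forall d e, P d -> 0 < e -> F (quasi_ent d e)) ->
  quasi_uniformity P `<=` F.
Proof.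
move=> FF F_ent E [_ [D sub_D <-] D_E]; apply: (filterS D_E).
apply: filter_bigI => A /sub_D /set_mem [d Pd [e e_gt0 <-]].
exact: F_ent.
Qed.

(** The sets that contain [(u (n + k), u n)] for all large [n] and all [k] form
    a filter; being right K-Cauchy says that the quasi-uniformity is contained
    in it. *)
Lemma right_K_cauchy_quasi_uniformity (R : realType) (X : Type)
    (P : set (X -> X -> R)) (u : nat -> X) :
  (forall d e, P d -> 0 < e ->
     \forall n \near \oo, forall k, d (u (n + k)%N) (u n) < e) ->
  right_K_cauchy (quasi_uniformity P) u.
Proof.
move=> u_small.
pose F : set_system (X * X) :=
  [set E | \forall n \near \oo, forall k, E (u (n + k)%N, u n)].
have FF : Filter F.
  split => [|A B|A B sAB]; rewrite /F /=.
  - exact: nearW.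
  - by apply: filterS2 => n An Bn k; split.
  - by apply: filterS => n An k; exact: sAB.
have subF := quasi_uniformity_sub_filter FF u_small.
by move=> E /subF [N _ FN]; exists N => n k; move/FN; exact.
Qed.

Lemma cvg_qnbhs_dist (R : realType) (X : Type) (P : set (X -> X -> R))
    (u : nat -> X) (x : X) (d : X -> X -> R) (e : R) :
  u @ \oo `=>` qnbhs (quasi_uniformity P) x -> P d -> 0 < e ->
  \forall n \near \oo, d x (u n) < e.
Proof.
move=> u_x Pd e_gt0.
have /u_x : qnbhs (quasi_uniformity P) x (xsection (quasi_ent d e) x).
  exists (quasi_ent d e) => //; exists (quasi_ent d e) => //.
  by apply: (finI_from1 id); exists d => //; exists e.
by move=> [N _ uN]; exists N => // n /uN /xsectionP.
Qed.

(** One step of the descent, in a form that can be iterated without leaving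
    the zeros of [f]: there the point itself is chosen. *)
Lemma descent_step (R : realType) (X : Type) (P : set (X -> X -> R))
    (eta : R -> R) (f : X -> \bar R) (gamma : R) :
  (forall d, P d -> quasi_pseudometric d) ->
  (forall t, 0 < t -> eta t < t) ->
  (forall x, (0 <= f x)%E) ->
  (forall x, (0 < f x)%E -> exists x',
     (forall d, P d -> (f x' + (gamma * d x' x)%:E <= f x)%E) /\
     (f x' <= er_map eta (f x))%E) ->
  forall x, (f x < +oo)%E -> exists x',
    [/\ (f x' <= f x)%E,
        fine (f x) > 0 -> fine (f x') <= eta (fine (f x)) &
        forall d, P d -> gamma * d x' x <= fine (f x) - fine (f x')].
Proof.
move=> hP eta_lt f_ge0 hb x fx_fin.
have [fx_gt0|fx_le0] := ltP 0%E (f x); last first.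
  have fx0 : f x = 0%E by apply/eqP; rewrite eq_le fx_le0 f_ge0.
  exists x; split => // [|d /hP [_ d_refl _]]; first by rewrite fx0 /= ltxx.
  by rewrite d_refl mulr0 subrr.
have [x' [dist_x' eta_x']] := hb x fx_gt0; exists x'.
move: fx_gt0 fx_fin (f_ge0 x') dist_x' eta_x'.
case: (f x) => [r| |] //=; rewrite lte_fin => r_gt0 _.
case: (f x') => [s| |] //= _ dist_x'; rewrite lee_fin => s_eta; split => //.
  by rewrite lee_fin (le_trans s_eta) // ltW // eta_lt.
by move=> d /dist_x'; rewrite -EFinD lee_fin -lerBrDl.
Qed.

Theorem theorem6p3 (R : realType) (X : Type) (P : set (X -> X -> R))
  (hP : forall d, P d -> quasi_pseudometric d)
  (hX : seq_right_K_complete (quasi_uniformity P))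
  (eta : R -> R)
  (eta_ge0 : forall t, 0 <= t -> 0 <= eta t)
  (eta_usc : upper_semicontinuous_on [set t : R | 0 <= t] eta)
  (eta_lt : forall t, 0 < t -> eta t < t)
  (f : X -> \bar R)
  (f_ge0 : forall x, (0 <= f x)%E)
  (ha : forall (u : nat -> X) (x : X),
     u @ \oo `=>` qnbhs (quasi_uniformity P) x ->
     f (u n) @[n --> \oo] --> 0%E -> f x = 0%E)
  (gamma : R) (gamma_gt0 : 0 < gamma)
  (hb : forall x, (0 < f x)%E -> exists x',
     (forall d, P d -> (f x' + (gamma * d x' x)%:E <= f x)%E) /\
     (f x' <= er_map eta (f x))%E) :
  forall x0, (f x0 < +oo)%E ->
    exists xbar,
      (f xbar = 0%E /\ ereal_inf (range f) = 0%E) /\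
      (forall d, P d -> ((d xbar x0)%:E <= f x0 / gamma%:E)%E).
Proof.
move=> x0 fx0_fin.
(* The guard makes [step] total on [X], as dependent choice requires. *)
pose step (x x' : X) := (f x < +oo)%E ->
  [/\ (f x' <= f x)%E,
      fine (f x) > 0 -> fine (f x') <= eta (fine (f x)) &
      forall d, P d -> gamma * d x' x <= fine (f x) - fine (f x')].
have step_ex x : {x' | step x x'}.
  apply: cid; have [fx_fin|fx_inf] := boolP (f x < +oo)%E.
    by have [x'] := descent_step hP eta_lt f_ge0 hb fx_fin; exists x'.
  by exists x => fx_fin; rewrite fx_fin in fx_inf.
have [u [u0 u_step]] := dependent_choice step_ex x0.
have fu_fin n : (f (u n) < +oo)%E.
  elim: n => [|n IHn]; first by rewrite u0.
  by have [fS _ _] := u_step n IHn; exact: le_lt_trans fS IHn.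
pose h n := fine (f (u n)).
have fuE n : f (u n) = (h n)%:E by rewrite /h fineK // ge0_fin_numE.
have h_ge0 n : 0 <= h n by rewrite -lee_fin -fuE.
have h_decr n : h n.+1 <= h n.
  by rewrite -lee_fin -!fuE; have [] := u_step n (fu_fin n).
have h_eta n : 0 < h n -> h n.+1 <= eta (h n).
  by have [] := u_step n (fu_fin n).
have h_cvg0 : h n @[n --> \oo] --> (0 : R).
  exact: (cvg0_of_usc_contraction eta_usc).
have dist_h d : P d ->
    forall n k, gamma * d (u (n + k)%N) (u n) <= h n - h (n + k)%N.
  move=> Pd; apply: telescope_dist => // [|n]; first exact: hP.
  by have [_ _ /(_ d Pd)] := u_step n (fu_fin n).
have u_cauchy : right_K_cauchy (quasi_uniformity P) u.
  apply: right_K_cauchy_quasi_uniformity => d e Pd e_gt0.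
  have ge_gt0 : 0 < gamma * e by rewrite mulr_gt0.
  have /cvgr_lt /(_ _ ge_gt0) := h_cvg0; apply: filterS => n hn k.
  rewrite -(ltr_pM2l gamma_gt0); apply: le_lt_trans hn.
  by apply: le_trans (dist_h d Pd n k) _; rewrite gerBl.
have [xbar u_xbar] := hX u u_cauchy.
have f_xbar : f xbar = 0%E.
  apply: ha u_xbar _; apply: cvg_EFin h_cvg0.
  by apply: nearW => n; rewrite fuE.
exists xbar; split; [split => //|].
  apply/eqP; rewrite eq_le; apply/andP; split.
    by apply: ereal_inf_lbound; exists xbar.
  by apply: le_ereal_inf_tmp => _ [x _ <-].
move=> d Pd; have [_ _ d_triangle] := hP d Pd.
rewrite -u0 fuE inver gt_eqF // -EFinM lee_fin.
apply/ler_addgt0Pr => e e_gt0.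
have [k _ /(_ k (leqnn k)) /= dk] := cvg_qnbhs_dist u_xbar Pd e_gt0.
apply: le_trans (d_triangle _ (u k) _) _.
rewrite addrC lerD ?(ltW dk) // ler_pdivlMr // mulrC.
by have := dist_h d Pd 0%N k; rewrite add0n => /le_trans; apply; rewrite gerBl.
Qed.
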